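(* Let $\mathcal{E}$ be a Euclidean vector space, $C$ a nonempty closed subset of $\mathcal{E}$, $S$ a nonempty proper subset of $C$, and $\varphi:\mathcal{E}\to\mathbb{R}$ a function that is continuous on $C$. Let $A$ be a $(\varphi,C,S)$-sufficient-descent map and $(x_i)_{i\in\mathbb{N}}$ be a sequence in $C\setminus S$ such that $x_{i+1}\in A(x_i)$ for all $i\in\mathbb{N}$. Then all accumulation points of $(x_i)_{i\in\mathbb{N}}$ are in $S$.
   Context: $B[x,\varepsilon]$ denotes the closed ball of center $x$ and radius $\varepsilon$ in $\mathcal{E}$. A $(\varphi,C,S)$-sufficient-descent map is a set-valued map $A$ from $C$ to $C$ such that: (1) $A(x)\neq\emptyset$ for all $x\in C$; (2) for every $\underline{x}\in C\setminus S$, there exist $\varepsilon(\underline{x}),\delta(\underline{x})\in(0,\infty)$ such that, for all $x\in B[\underline{x},\varepsilon(\underline{x})]\cap C$, $\varphi(x)-\sup\varphi(A(x))\ge\delta(\underline{x})$. *)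

(* Defs.v *)
From HB Require Import structures.
From mathcomp Require Import all_boot all_order all_algebra.
From mathcomp Require Import all_classical all_reals all_analysis.

Set Implicit Arguments.
Unset Strict Implicit.
Unset Printing Implicit Defensive.

Import Order.TTheory GRing.Theory Num.Theory.
Import numFieldNormedType.Exports.

Local Open Scope classical_set_scope.
Local Open Scope ring_scope.

(* The inner product is the positive definite symmetric bilinear form [edot];
   [norm_edot] ties the library norm, hence the topology, to it.  Finite
   dimension comes from [Vector]. *)
HB.mixin Record NormedModule_Vector_isEuclidean (R : realType) E
    of NormedModule R E & Vector R E := {
  edot : {dot E for (@idfun R)} ;
  norm_edot : forall x : E, `|x| = Num.sqrt (edot x x)
}.

#[short(type="euclideanType")]
HB.structure Definition Euclidean (R : realType) :=
  {E of NormedModule R E & Vector R E & NormedModule_Vector_isEuclidean R E}.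

(* The values of [A] outside [C] are irrelevant.  The supremum is taken in
   [\bar R], where the last inequality fails if it is [+oo]. *)
Definition sufficient_descent_map (R : realType) (E : euclideanType R)
    (phi : E -> R) (C S : set E) (A : E -> set E) : Prop :=
  [/\ (forall x, C x -> A x `<=` C),
      (forall x, C x -> A x !=set0) &
      (forall x0, (C `\` S) x0 ->
        exists eps delta : R, [/\ 0 < eps, 0 < delta &
          forall x, (closed_ball_ Num.norm x0 eps `&` C) x ->
            (delta%:E <=
             (phi x)%:E - ereal_sup [set (phi y)%:E | y in A x])%E])].

(* Main.v *)
(* The values [phi (x i)] decrease along the sequence.  Near an accumulation
   point [p] of [C \ S], continuity keeps [phi] within [delta / 2] of [phi p],
   while one step from there drops [phi] by [delta], below [phi p - delta / 2];
   by monotonicity the sequence could then never return near [p]. *)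
Require Import Defs.
From HB Require Import structures.
From mathcomp Require Import all_boot all_order all_algebra.
From mathcomp Require Import all_classical all_reals all_analysis.
From mathcomp Require Import lra.

Import Order.TTheory GRing.Theory Num.Theory.
Import numFieldNormedType.Exports.

Local Open Scope classical_set_scope.
Local Open Scope ring_scope.

(** The point [y] of [B] excludes the value [-oo] of the supremum and the real lower bound [delta]
    excludes [+oo], so only real numbers remain to be compared. *)
Lemma sufficient_decrease {R : realType} {T : Type} {phi : T -> R} {B : set T}
    {a delta : R} {y : T} :
  (delta%:E <= a%:E - ereal_sup [set (phi z)%:E | z in B])%E -> B y ->
  phi y <= a - delta.
Proof.
move=> le_delta By.
have : ((phi y)%:E <= ereal_sup [set (phi z)%:E | z in B])%E.
  by apply: ereal_sup_ubound; exists y.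
case: (ereal_sup _) le_delta => [s| |] //=.
by rewrite -EFinB !lee_fin; lra.
Qed.

Theorem proposition3p2 (R : realType) (E : euclideanType R)
    (C : set E) (hC0 : C !=set0) (hC : closed C)
    (S : set E) (hS0 : S !=set0) (hS : S `<` C)
    (phi : E -> R) (hphi : {within C, continuous phi})
    (A : E -> set E) (hA : sufficient_descent_map phi C S A)
    (x : nat -> E) (hx : forall i, (C `\` S) (x i))
    (hxA : forall i, A (x i) (x i.+1)) :
  cluster (x @ \oo) `<=` S.
Proof.
case: hA => _ _ hdesc p clp.
(* The image of each tail belongs to the filter [x @ \oo], so it meets [U]. *)
have cluster_often (U : set E) (n : nat) : nbhs p U ->
    exists2 i, (n <= i)%N & U (x i).
  move=> pU.
  have [|_ [[i /= ni <-] Ui]] := clp (x @` [set i | (n <= i)%N]) U _ pU.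
    by exists n => // i /= ni; exists i.
  by exists i.
have Cp : C p.
  apply: hC => U /(cluster_often _ 0) [i _ Ui].
  by exists (x i); split => //; case: (hx i).
apply: contrapT => Sp.
have phi_decr : {homo phi \o x : i j / (i <= j)%N >-> j <= i}.
  apply: homo_leq => [i //|j i k ji kj|i /=]; first exact: le_trans kj ji.
  (* The descent condition is taken at [x i] itself, the center of its own ball. *)
  have [eps [delta [eps0 delta0 h]]] := hdesc _ (hx i).
  have [Cxi _] := hx i.
  have := sufficient_decrease (h (x i) _) (hxA i).
  rewrite /closed_ball_ /= subrr normr0 => /(_ (conj (ltW eps0) Cxi)); lra.
have [eps [delta [eps0 delta0 h]]] := hdesc p (conj Cp Sp).
have delta2 : 0 < delta / 2 by rewrite divr_gt0.
have /subspace_continuousP/(_ p Cp)/cvgrPdist_lt/(_ _ delta2) near_phi := hphi.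
have [i _ [xi_ball xi_near]] :=
  cluster_often _ 0 (filterI (nbhsx_ballx p eps eps0) near_phi).
(* Searching from [i.+1] puts [x j] after the drop at [x i], so that [phi (x j) <= phi (x i.+1)]. *)
have [j ij xj_near] := cluster_often _ i.+1 near_phi.
have [Cxi _] := hx i; have [Cxj _] := hx j.
have := sufficient_decrease (h (x i) _) (hxA i).
move: xi_ball; rewrite -ball_normE => /ltW xi_ball /(_ (conj xi_ball Cxi)).
move: (phi_decr _ _ ij) (xi_near Cxi) (xj_near Cxj) => /=.
rewrite /from_subspace !ltr_norml => ? /andP[? ?] /andP[? ?] ?; lra.
Qed.
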